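(* Let $L\subset\mathbb{R}^n$ be an $n$-dimensional lattice such that for every nonzero vector $v\in L$ the reflection $\mathcal{R}_v$ defined by $v$ is a coincidence isometry of $L$. Then any coincidence isometry of $L$ can be decomposed as a product of at most $n$ reflections defined by (nonzero) vectors in $L$.
   Context: $\mathbb{R}^n$ carries the standard inner product $(\cdot,\cdot)$. An $n$-dimensional lattice $L\subset\mathbb{R}^n$ is a subgroup $L=\bigoplus_{i=1}^n\mathbb{Z}b_i$, where $(b_1,\dots,b_n)$ is a basis of the real vector space $\mathbb{R}^n$. Let $O(n)$ be the group of orthogonal transformations of $\mathbb{R}^n$. A coincidence isometry of $L$ is an element of $OC(L)=\{\mathcal{R}\in O(n): [L:L\cap\mathcal{R}L]<\infty\}$. For nonzero $v\in\mathbb{R}^n$, the reflection defined by $v$ is $\mathcal{R}_v(x)=x-\frac{2(x,v)}{(v,v)}v$ for $x\in\mathbb{R}^n$. The empty product (zero reflections) is the identity. *)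

(* Defs.v *)
From mathcomp Require Import all_boot all_order all_algebra.
From mathcomp Require Import all_classical all_reals.

Set Implicit Arguments.
Unset Strict Implicit.
Unset Printing Implicit Defensive.

Import Order.TTheory GRing.Theory Num.Theory.

Local Open Scope classical_set_scope.
Local Open Scope ring_scope.

Definition inner (R : realType) (n : nat) (x y : 'rV[R]_n) : R :=
  \sum_(i < n) x 0 i * y 0 i.

Definition is_lattice (R : realType) (n : nat) (L : set 'rV[R]_n) : Prop :=
  exists b : n.-tuple 'rV[R]_n,
    basis_of {: 'rV[R]_n} b
    /\ L = [set \sum_(i < n) tnth b i *~ z i | z in [set: 'I_n -> int]].

(* An element of O(n), as a map; bijectivity is automatic here. *)
Definition orthogonal_transformation (R : realType) (n : nat)
    (f : 'rV[R]_n -> 'rV[R]_n) : Prop :=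
  linear f /\ forall x y, inner (f x) (f y) = inner x y.

(* [G : H] is finite: the set of the cosets x + H with x in G is finite.
   Meaningful when H is a subgroup of G. *)
Definition finite_index (V : zmodType) (G H : set V) : Prop :=
  finite_set [set [set x + h | h in H] | x in G].

Definition coincidence_isometry (R : realType) (n : nat)
    (L : set 'rV[R]_n) (f : 'rV[R]_n -> 'rV[R]_n) : Prop :=
  orthogonal_transformation f /\ finite_index L (L `&` f @` L).

Definition reflection (R : realType) (n : nat) (v x : 'rV[R]_n) : 'rV[R]_n :=
  x - (2 * inner x v / inner v v) *: v.

(* Main.v *)
Require Import Defs.
From HB Require Import structures.
From mathcomp Require Import all_boot all_order all_algebra.
From mathcomp Require Import all_classical all_reals.
From mathcomp Require Import ring.

Import Order.TTheory GRing.Theory Num.Theory.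

Local Open Scope classical_set_scope.
Local Open Scope ring_scope.

(** This is the proof of the Cartan-Dieudonne theorem for a definite form, with
    every mirror vector kept inside [L].  Fix the basis vectors of [L] one at
    a time.  Suppose that an isometry [g] already fixes some of them, and let
    [b] be the next one.  The reflection in [b - g^-1 b] exchanges [b] and
    [g^-1 b], which have the same length, so composing it with [g] gives an
    isometry fixing [b].  Since [g] fixes the earlier basis vectors, they are
    orthogonal to [b - g^-1 b] and remain fixed.  After [n] steps the isometry
    that is left fixes a basis, hence is the identity.

    What is specific to lattices is that a multiple of [b - g^-1 b] must lie in
    [L].  A coincidence isometry [g] has this property because the finite group
    [L / (L /\ g L)] is torsion: some [m b] with [m > 0] is [g y] for a [y] in
    [L], and then [m b - y] is a mirror vector in [L].  Torsion modulo [g L]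
    ([torsion_mod_image]) is all that is retained of the coincidence property;
    it passes to compositions, so it survives each step since the reflections
    in vectors of [L] are assumed to be coincidence isometries. *)

(** * The inner product and reflections *)

Section InnerProduct.
Context {R : realType} {n : nat}.
Implicit Types (x y v a c : 'rV[R]_n).

Lemma innerC x y : inner x y = inner y x.
Proof. by apply: eq_bigr => i _; rewrite mulrC. Qed.

Lemma innerBl x y v : inner (x - y) v = inner x v - inner y v.
Proof. by rewrite -sumrB; apply: eq_bigr => i _; rewrite !mxE mulrBl. Qed.

Lemma innerZl k x v : inner (k *: x) v = k * inner x v.
Proof. by rewrite mulr_sumr; apply: eq_bigr => i _; rewrite !mxE mulrA. Qed.

Lemma innerBr x y v : inner v (x - y) = inner v x - inner v y.
Proof. by rewrite innerC innerBl !(innerC v). Qed.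

Lemma inner_eq0 v : (inner v v == 0) = (v == 0).
Proof.
apply/eqP/eqP => [v0|->]; last by rewrite /inner big1 // => i _; rewrite mxE mul0r.
apply/rowP => i; rewrite mxE; apply/eqP; rewrite -sqrf_eq0 expr2; apply/eqP.
by apply: (psumr_eq0P _ v0) => // j _; rewrite -expr2 sqr_ge0.
Qed.

Lemma reflectionK {v} : v != 0 -> involutive (@reflection R n v).
Proof.
rewrite -inner_eq0 => v0 x; rewrite /reflection innerBl innerZl -addrA -opprD.
rewrite -scalerDl [X in X *: v](_ : _ = 0) ?scale0r ?subr0 //.
by field.
Qed.

Lemma reflection_orthogonal v x : inner x v = 0 -> reflection v x = x.
Proof. by rewrite /reflection => ->; rewrite mulr0 mul0r scale0r subr0. Qed.

(** The vectors [a - c] and [a + c] are orthogonal when [a] and [c] have equal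
    lengths; hence [2 (a, a - c) = (a - c, a - c)]. *)
Lemma reflection_exchange a c :
  a - c != 0 -> inner a a = inner c c -> reflection (a - c) a = c.
Proof.
move=> ac0 ac; rewrite /reflection.
suff -> : 2 * inner a (a - c) = inner (a - c) (a - c).
  by rewrite divff ?inner_eq0 // scale1r subKr.
by rewrite !innerBl !innerBr -ac (innerC c a); ring.
Qed.

End InnerProduct.

(** * Orthogonal transformations *)

Section Orthogonal.
Context {R : realType} {n : nat}.
Implicit Types (f g : 'rV[R]_n -> 'rV[R]_n).

Lemma linear_mulrn {f} : linear f -> forall x m, f (x *+ m) = f x *+ m.
Proof.
move=> lf; pose F : {linear 'rV[R]_n -> 'rV[R]_n} :=
  HB.pack f (GRing.isLinear.Build _ _ _ _ f lf).
by move=> x m; apply: (linearMn F m x).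
Qed.

Lemma linear_basis_id {f} {b : n.-tuple 'rV[R]_n} :
  linear f -> basis_of {: 'rV[R]_n} b -> {in b, forall x, f x = x} -> f = id.
Proof.
move=> lf bb fb; pose F : {linear 'rV[R]_n -> 'rV[R]_n} :=
  HB.pack f (GRing.isLinear.Build _ _ _ _ f lf).
apply/funext => x; rewrite (coord_basis bb (memvf x)) -[f]/(F : _ -> _).
rewrite linear_sum; apply: eq_bigr => i _; rewrite linearZ; congr (_ *: _).
by apply: fb; rewrite mem_nth // size_tuple.
Qed.

Lemma orthogonal_comp {f g} :
  orthogonal_transformation f -> orthogonal_transformation g ->
  orthogonal_transformation (f \o g).
Proof.
move=> [lf nf] [lg ng]; split=> [k x y|x y] /=; first by rewrite lg lf.
by rewrite nf ng.
Qed.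

End Orthogonal.

(** * Torsion of L modulo the image of a map *)

(** In terms of the rational span of [L], this says that an injective
    linear [f] satisfies [f^-1 (QL) <= QL]. *)
Definition torsion_mod_image {V : zmodType} (L : set V) (f : V -> V) :=
  forall x, L x -> exists m y, [/\ (0 < m)%N, L y & f y = x *+ m].

Lemma torsion_mod_image_comp {V : zmodType} {L : set V} {f g : V -> V} :
  (forall x m, f (x *+ m) = f x *+ m) ->
  torsion_mod_image L f -> torsion_mod_image L g ->
  torsion_mod_image L (f \o g).
Proof.
move=> fM Tf Tg x /Tf[m [y [m0 Ly fy]]]; have [k [z [k0 Lz gz]]] := Tg y Ly.
exists (m * k)%N, z; split; rewrite ?muln_gt0 ?m0 //=.
by rewrite gz fM fy mulrnA.
Qed.

Lemma finite_set_pigeonhole {T : Type} {A : set T} {F : nat -> T} :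
  finite_set A -> (forall k, A (F k)) ->
  exists i j : nat, (i < j)%N /\ F i = F j.
Proof.
move=> finA AF; apply: contrapT => noeq; apply: infinite_nat.
have -> : [set: nat] = F @^-1` A by apply/seteqP; split=> k // _; apply: AF.
apply: finite_preimage => // i j _ _ Fij.
by case: (ltngtP i j) => // ij; case: noeq; [exists i, j | exists j, i].
Qed.

Lemma subgroup_mulrn {V : zmodType} {L : set V} :
  L 0 -> (forall x y, L x -> L y -> L (x - y)) ->
  forall x m, L x -> L (x *+ m).
Proof.
move=> L0 LB x m Lx; elim: m => [|m IHm]; first by rewrite mulr0n.
by rewrite mulrS -[_ *+ m]opprK; apply: (LB) => //; rewrite -sub0r; apply: LB.
Qed.

(** Among the multiples of [x] two lie in the same coset of [H]. *)
Lemma finite_index_torsion {V : zmodType} {L H : set V} :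
  L 0 -> (forall x y, L x -> L y -> L (x - y)) -> H 0 ->
  finite_index L H ->
  forall x, L x -> exists2 m, (0 < m)%N & H (x *+ m).
Proof.
move=> L0 LB H0 fin x Lx.
have [|i [j [ij eqij]]] :=
    finite_set_pigeonhole (F := fun k => [set x *+ k + h | h in H]) fin.
  by move=> k; exists (x *+ k) => //; apply: subgroup_mulrn.
have : [set x *+ j + h | h in H] (x *+ j) by exists 0; rewrite ?addr0.
rewrite -eqij => -[h Hh hE]; exists (j - i)%N; first by rewrite subn_gt0.
by rewrite mulrnBr ?(ltnW ij) // -hE addrC addKr.
Qed.

Lemma coincidence_torsion {R : realType} {n : nat} {L : set 'rV[R]_n} {f} :
  L 0 -> (forall x y, L x -> L y -> L (x - y)) ->
  coincidence_isometry L f -> torsion_mod_image L f.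
Proof.
move=> L0 LB [[lf _] fin] x Lx.
have f0 : f 0 = 0 by rewrite -(mulr0n 0) linear_mulrn.
have H0 : (L `&` f @` L) 0 by split=> //; exists 0.
have [m m0 [_ [y Ly fy]]] := finite_index_torsion L0 LB H0 fin _ Lx.
by exists m, y.
Qed.

Lemma lattice_subgroup {R : realType} {n : nat} (b : n.-tuple 'rV[R]_n) :
  let L := [set \sum_(i < n) tnth b i *~ z i | z in [set: 'I_n -> int]] in
  [/\ L 0, forall x y, L x -> L y -> L (x - y) & {in b, forall x, L x}].
Proof.
split=> [|_ _ [z _ <-] [t _ <-]|_ /tnthP[i ->]].
- by exists (fun=> 0) => //; rewrite big1.
- exists (fun i => z i - t i) => //; rewrite -sumrB.
  by apply: eq_bigr => i _; rewrite mulrzBr.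
- exists (fun j => (j == i)%:Z) => //; rewrite (bigD1 i) //= eqxx.
  by rewrite big1 ?addr0 // => j /negPf->.
Qed.

(** * Fixing lattice vectors one at a time *)

Section Decomposition.
Context {R : realType} {n : nat} {L : set 'rV[R]_n}.
Hypothesis L0 : L 0.
Hypothesis LB : forall x y, L x -> L y -> L (x - y).
Hypothesis L_refl : forall v, L v -> v != 0 ->
  coincidence_isometry L (reflection v).

(** Each vector of [s] costs at most one reflection.  Reflections are
    involutions, so replacing [g] by [g \o reflection v] is compensated by
    putting [v] at the head of [vs]. *)
Lemma fix_lattice_vectors {s : seq 'rV[R]_n} {f} :
  orthogonal_transformation f -> torsion_mod_image L f ->
  {in s, forall x, L x} ->
  exists vs g,
    [/\ (size vs <= size s)%N, forall v, v \in vs -> L v /\ v != 0,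
        orthogonal_transformation g /\ torsion_mod_image L g,
        {in s, forall x, g x = x}
      & f = g \o \big[comp/id]_(v <- vs) reflection v].
Proof.
move=> Of Tf; elim: s => [|b s IHs] Ls.
  by exists [::], f; split=> //; rewrite big_nil.
have [x xs|vs [g [szvs Lvs [Og Tg] gs fE]]] := IHs.
  by apply: Ls; rewrite inE xs orbT.
have Lb : L b by apply: Ls; rewrite mem_head.
have [m [y [m0 Ly gy]]] := Tg b Lb.
have [lg ng] := Og.
(* The mirror vector is the multiple by m of b - g^-1 b. *)
pose v := b *+ m - y.
have Lv : L v by apply: LB => //; apply: subgroup_mulrn.
have mulrnI z : z *+ m = b *+ m -> z = b.
  move/eqP; rewrite -subr_eq0 -mulrnBl -scaler_nat scaler_eq0 pnatr_eq0.
  by rewrite eqn0Ngt m0 /= subr_eq0 => /eqP.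
have [v0|v0] := eqVneq v 0.
  exists vs, g; split=> //=; first exact: leqW.
  move=> x; rewrite inE => /predU1P[->|/gs//].
  apply: mulrnI; rewrite -linear_mulrn //.
  by rewrite -[RHS]gy; move/eqP: v0; rewrite subr_eq0 => /eqP->.
have Cv := L_refl _ Lv v0; have [Ov _] := Cv; have [lv _] := Ov.
exists (v :: vs), (g \o reflection v); split=> //=.
- by move=> u; rewrite inE => /predU1P[->|us]; [split | apply: Lvs].
- split; first exact: orthogonal_comp.
  apply: torsion_mod_image_comp => //; last exact: coincidence_torsion.
  exact: linear_mulrn.
- move=> x; rewrite inE => /predU1P[->|xs].
    apply: mulrnI; rewrite /= -(linear_mulrn lg) -(linear_mulrn lv).
    by rewrite reflection_exchange // -gy ng.
  (* v is orthogonal to x because g fixes x and preserves inner products. *)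
  rewrite /= reflection_orthogonal ?gs // innerBr -(ng x y) gs // gy.
  exact: subrr.
- rewrite big_cons fE; apply/funext => x /=.
  by rewrite reflectionK.
Qed.

End Decomposition.

Theorem theorem3p1 (R : realType) (n : nat) (L : set 'rV[R]_n)
    (L_lattice : is_lattice L)
    (L_refl : forall v : 'rV[R]_n,
      L v -> v != 0 -> coincidence_isometry L (reflection v))
    (f : 'rV[R]_n -> 'rV[R]_n) (f_OC : coincidence_isometry L f) :
  exists vs : seq 'rV[R]_n,
    [/\ (size vs <= n)%N,
        (forall v, v \in vs -> L v /\ v != 0)
      & f = \big[comp/id]_(v <- vs) reflection v].
Proof.
have [b [bb LE]] := L_lattice.
have [L0 LB Lb] := lattice_subgroup b.
rewrite -LE in L0 LB Lb.
have [Of _] := f_OC; have Tf := coincidence_torsion L0 LB f_OC.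
have [vs [g [szvs Lvs [[lg _] _] gb ->]]] :=
  fix_lattice_vectors L0 LB L_refl Of Tf Lb.
exists vs; split=> //; first by rewrite size_tuple in szvs.
by rewrite (linear_basis_id lg bb gb).
Qed.
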